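(* Let $n\in\{1,2,3\}$, let $Q'$ be any quiver whose underlying graph is the Dynkin graph $A_n$ (a path on vertices $1,\dots,n$ with arbitrary orientation of the edges), let $N_1,\dots,N_n\geq 0$ be integers, and let $Q$ be obtained from $Q'$ by adding $N_i$ loops at vertex $i$. Let $A=\Bbbk Q/(\geq 2)$. Then $$\operatorname{fpd}(A\text{-mod})=\max\{N_1,\dots,N_n\}.$$ In particular, for $n\le 3$ the Frobenius–Perron dimension of the modified type-A algebra $A(n)$ does not depend on the orientation of the non-loop arrows.
   Context: $\Bbbk$ is an algebraically closed field; $\Bbbk Q$ is the path algebra with $e_i\alpha=\delta_{i,t(\alpha)}\alpha$, $\alpha e_j=\delta_{j,s(\alpha)}\alpha$; $(\geq 2)$ is the ideal generated by paths of length $\geq 2$; $A\text{-mod}$ is the category of finite-dimensional left $A$-modules. For a $\Bbbk$-linear abelian category $\mathcal C$: an object $M$ is a brick if $\mathrm{Hom}(M,M)=\Bbbk$; a finite set $\phi=\{X_1,\dots,X_k\}$ of nonzero objects is a brick set if each $X_i$ is a brick and $\dim\mathrm{Hom}(X_i,X_j)=\delta_{ij}$; its adjacency matrix is $A(\phi)=(\dim\mathrm{Ext}^1_{\mathcal C}(X_i,X_j))_{i,j}$; and $\operatorname{fpd}(\mathcal C)=\sup_{\phi}\rho(A(\phi))$, the supremum over all brick sets of the spectral radius $\rho$. *)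

(* Defs.v *)
From HB Require Import structures.
From mathcomp Require Import all_boot all_order all_algebra all_field.
Set Implicit Arguments. Unset Strict Implicit. Unset Printing Implicit Defensive.
Import Order.TTheory GRing.Theory Num.Theory.
Local Open Scope ring_scope.

Record quiver := Quiver {
  qv : nat;
  qa : nat;
  qs : 'I_qa -> 'I_qv;
  qt : 'I_qa -> 'I_qv }.

(* Generators of kQ (and of A = kQ/(>=2)): idempotents e_i (inl i) and arrows (inr a). *)
Definition qgen (Q : quiver) := ('I_(qv Q) + 'I_(qa Q))%type.

(* A finite-dimensional left module over A given in coordinates: the space is k^adim
   (column vectors) and aact g is the matrix by which generator g acts. *)
Record amod (k : fieldType) (Q : quiver) := AMod {
  adim : nat;
  aact : qgen Q -> 'M[k]_adim }.

Definition is_amod (k : fieldType) (Q : quiver) (M : amod k Q) : Prop :=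
  [/\ forall i j : 'I_(qv Q),
        aact M (inl i) *m aact M (inl j) = (if i == j then aact M (inl i) else 0),
      \sum_(i < qv Q) aact M (inl i) = 1%:M,
      forall a : 'I_(qa Q),
        aact M (inl (qt a)) *m aact M (inr a) = aact M (inr a) /\
        aact M (inr a) *m aact M (inl (qs a)) = aact M (inr a)
    & forall a b : 'I_(qa Q), aact M (inr b) *m aact M (inr a) = 0 ].

(* The standard complex computing Hom_A(M,N) and Ext^1_A(M,N) for a finitely
   presented algebra:  Hom_k(M,N) --d0--> {cochains on generators} --d1--> {relations},
   d0 h = (N_g h - h M_g)_g  (inner derivations), and d1 F = derivation defect of F on
   each defining relation.  ker d0 = Hom_A(M,N); ker d1 / im d0 = Der(A,Hom_k(M,N))/Inn
   = Ext^1_A(M,N) (equivalently, ker d1 = block-triangular extensions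
   [[N_g, F_g],[0, M_g]] that are A-modules, im d0 = split ones). *)
Definition d0 (k : fieldType) (Q : quiver) (M N : amod k Q)
  (h : 'M[k]_(adim N, adim M)) : {ffun qgen Q -> 'M[k]_(adim N, adim M)} :=
  [ffun g => aact N g *m h - h *m aact M g].

Definition qrel (Q : quiver) :=
  (('I_(qv Q) * 'I_(qv Q)) + (unit + (('I_(qa Q) * bool) + ('I_(qa Q) * 'I_(qa Q)))))%type.

Definition d1 (k : fieldType) (Q : quiver) (M N : amod k Q)
  (F : {ffun qgen Q -> 'M[k]_(adim N, adim M)}) :
  {ffun qrel Q -> 'M[k]_(adim N, adim M)} :=
  [ffun r : qrel Q =>
     match r with
     | inl (i, j) =>
         aact N (inl i) *m F (inl j) + F (inl i) *m aact M (inl j)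
         - (if i == j then F (inl i) else 0)
     | inr (inl _) => \sum_(i < qv Q) F (inl i)
     | inr (inr (inl (a, true))) =>
         aact N (inl (qt a)) *m F (inr a) + F (inl (qt a)) *m aact M (inr a) - F (inr a)
     | inr (inr (inl (a, false))) =>
         aact N (inr a) *m F (inl (qs a)) + F (inr a) *m aact M (inl (qs a)) - F (inr a)
     | inr (inr (inr (a, b))) =>
         aact N (inr b) *m F (inr a) + F (inr b) *m aact M (inr a)
     end].

Definition homdim (k : fieldType) (Q : quiver) (M N : amod k Q) : nat :=
  \dim (lker (linfun (@d0 k Q M N))).

Definition extdim (k : fieldType) (Q : quiver) (M N : amod k Q) : nat :=
  (\dim (lker (linfun (@d1 k Q M N))) - \dim (limg (linfun (@d0 k Q M N))))%N.

(* Hom(M,M) = k  (End always contains the scalars) *)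
Definition is_brick (k : fieldType) (Q : quiver) (M : amod k Q) : Prop :=
  homdim M M = 1%N.

Definition brick_set (k : fieldType) (Q : quiver) (phi : seq (amod k Q)) : Prop :=
  (forall i j : 'I_(size phi),
     let Xi := tnth (in_tuple phi) i in let Xj := tnth (in_tuple phi) j in
     [/\ is_amod Xi, (0 < adim Xi)%N & homdim Xi Xj = (i == j : nat)]).

Definition adjmx (k : fieldType) (Q : quiver) (phi : seq (amod k Q)) :
  'M[nat]_(size phi) :=
  \matrix_(i, j) extdim (tnth (in_tuple phi) i) (tnth (in_tuple phi) j).

(* spectral radius of a complex (algebraic) matrix: max modulus of the roots
   of its characteristic polynomial (0 for the empty matrix). *)
Definition eigenseq (r : nat) (B : 'M[algC]_r) : seq algC :=
  sval (closed_field_poly_normal (char_poly B)).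

Definition specrad (r : nat) (B : 'M[algC]_r) : algC :=
  \big[Num.max/0]_(z <- eigenseq B) `|z|.

Definition specrad_nat (r : nat) (B : 'M[nat]_r) : algC :=
  specrad (map_mx (fun m : nat => m%:R : algC) B).

(* Main.v *)
(* Since rad^2 = 0, a brick X is either a simple S_i or has disjoint top and socle
   (a vertex in both gives a rank one endomorphism), and for distinct members X, Y
   of a brick set the top of X is disjoint from the socle of Y.  Loops then
   contribute nothing to Ext(X, Y) unless X = Y = S_i, where they contribute N_i,
   and counting cochains gives the Euler-type inequality
     dim Ext(X, Y) + sum_i dim X_i dim Y_i
       <= dim Hom(X, Y) + sum_(a : i -> j) dim top(X)_i dim soc(Y)_j.
   For X = Y nonsimple, positive definiteness of the A_3 form forces Ext(X, X) = 0
   and dim X_i <= 1.  Let w be a function on vertices growing by 1 along each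
   arrow, and let the level of X be (w on its top) + (w on its socle).  If
   Ext(X, Y) <> 0 then an arrow joins the top of X to the socle of Y, so
   level Y - level X = 2 - (number of nonsimple modules among X, Y), and for two
   distinct nonsimple X, Y the inequality gives Ext = 0 when n <= 3 (a finite check
   on dimension vectors).  Hence Ext strictly raises the level off
   the diagonal, the adjacency matrix is triangular up to reordering, and its
   eigenvalues are diagonal entries, which are at most max N_i.  The bound is
   attained at the brick set {S_i} with N_i maximal. *)
Require Import Defs.
From HB Require Import structures.
From mathcomp Require Import all_boot all_order all_algebra all_field.
From mathcomp Require Import zify.
Set Implicit Arguments. Unset Strict Implicit. Unset Printing Implicit Defensive.
Import Order.TTheory GRing.Theory Num.Theory.
Local Open Scope ring_scope.

(** * Euler inequality for Ext *)

(** For idempotents [A] and [B] the image is the block of matrices fixed by [A] on the left and by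
    [B] on the right, that is, the maps from one vertex space to another. *)
Definition sandwich (k : fieldType) (m n p q : nat) (A : 'M[k]_(m, n))
  (B : 'M[k]_(p, q)) : 'Hom('M[k]_(n, p), 'M[k]_(m, q)) :=
  linfun (mulmxr B \o mulmx A).

Lemma sandwichE (k : fieldType) (m n p q : nat) (A : 'M[k]_(m, n))
  (B : 'M[k]_(p, q)) (E : 'M[k]_(n, p)) : sandwich A B E = A *m E *m B.
Proof. by rewrite lfunE. Qed.

(** Rank factorizations of [A] and [B] split the map into a surjection onto matrices of size
    [\rank A] by [\rank B], followed by an injection. One-sided inverses of the bases witness both
    claims. *)
Lemma dim_limg_sandwich (k : fieldType) (m n p q : nat) (A : 'M[k]_(m, n))
  (B : 'M[k]_(p, q)) : \dim (limg (sandwich A B)) = (\rank A * \rank B)%N.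
Proof.
have -> : sandwich A B = (sandwich (col_base A) (row_base B)
                          \o sandwich (row_base A) (col_base B))%VF.
  apply/lfunP => E; rewrite comp_lfunE !sandwichE.
  by rewrite -{1}(mulmx_base A) -{1}(mulmx_base B) !mulmxA.
have [A' AA'] := row_freeP (row_base_free A).
have [B' BB'] := row_freeP (row_base_free B).
have [A1 A1A] := row_fullP (col_base_full A).
have [B1 B1B] := row_fullP (col_base_full B).
rewrite limg_comp.
have -> : limg (sandwich (row_base A) (col_base B)) = fullv.
  move: (row_base A) (col_base B) AA' B1B => RA CB AA' B1B {BB' A1A}.
  apply/eqP; rewrite eqEsubv subvf /=; apply/subvP => G _.
  apply/memv_imgP; exists (A' *m G *m B1); first exact: memvf.
  by rewrite sandwichE !mulmxA AA' mul1mx -mulmxA B1B mulmx1.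
move: (col_base A) (row_base B) BB' A1A => CA RB BB' A1A {AA' B1B}.
rewrite limg_dim_eq ?dimvf ?dim_matrix //.
apply/eqP; rewrite -subv0; apply/subvP => G /memv_capP[_].
rewrite memv_ker sandwichE memv0 => /eqP G0; apply/eqP.
have /= := congr1 (fun M => A1 *m M *m B') G0.
by rewrite mulmx0 mul0mx -!mulmxA BB' mulmx1 mulmxA A1A mul1mx.
Qed.

(** * Cocycles modulo inner derivations *)

Definition vertex_part (k : fieldType) (Q : quiver) (V : lmodType k)
  (F : {ffun qgen Q -> V}) : {ffun 'I_(qv Q) -> V} := [ffun i => F (inl i)].

Fact vertex_part_is_linear (k : fieldType) (Q : quiver) (V : lmodType k) :
  linear (@vertex_part k Q V).
Proof. by move=> c F G; apply/ffunP => i; rewrite !ffunE. Qed.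

HB.instance Definition _ (k : fieldType) (Q : quiver) (V : lmodType k) :=
  GRing.isLinear.Build k _ _ _ (@vertex_part k Q V) (@vertex_part_is_linear k Q V).

Fact d0_is_linear (k : fieldType) (Q : quiver) (X Y : amod k Q) :
  linear (@d0 k Q X Y).
Proof.
move=> c h h'; apply/ffunP => g; rewrite !ffunE mulmxDr mulmxDl.
by rewrite -scalemxAr -scalemxAl scalerBr opprD addrACA.
Qed.

HB.instance Definition _ (k : fieldType) (Q : quiver) (X Y : amod k Q) :=
  GRing.isLinear.Build k _ _ _ (@d0 k Q X Y) (@d0_is_linear k Q X Y).

Fact d1_is_linear (k : fieldType) (Q : quiver) (X Y : amod k Q) :
  linear (@d1 k Q X Y).
Proof.
have ACA (V : lmodType k) (c : k) (u v w z p q : V) :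
    c *: u + v + (c *: w + z) - (c *: p + q) = c *: (u + w - p) + (v + z - q).
  by rewrite scalerBr scalerDr opprD (addrACA _ v) [LHS]addrACA.
move=> c F G; apply/ffunP => r; rewrite !ffunE.
case: r => [[i j]|[u|[[a []]|[a b]]]]; rewrite ?ffunE ?mulmxDr ?mulmxDl
  -?scalemxAr -?scalemxAl ?ACA //.
- case: (i == j); rewrite ?subr0 ?ACA //.
  by rewrite scalerDr addrACA.
- by rewrite scaler_sumr -big_split; apply: eq_bigr => i _; rewrite !ffunE.
- by rewrite scalerDr addrACA.
Qed.

HB.instance Definition _ (k : fieldType) (Q : quiver) (X Y : amod k Q) :=
  GRing.isLinear.Build k _ _ _ (@d1 k Q X Y) (@d1_is_linear k Q X Y).

Lemma d1_d0 (k : fieldType) (Q : quiver) (X Y : amod k Q)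
  (h : 'M[k]_(adim Y, adim X)) :
  is_amod X -> is_amod Y -> d1 (d0 h) = 0.
Proof.
move=> [X1 X2 X3 X4] [Y1 Y2 Y3 Y4]; apply/ffunP => r; rewrite !ffunE.
case: r => [[i j]|[u|[[a []]|[a b]]]]; rewrite ?ffunE ?mulmxBr ?mulmxBl ?mulmxA.
- rewrite Y1 -[h *m _ *m _]mulmxA X1 addrA subrK.
  by case: (i == j); rewrite ?mul0mx ?mulmx0 ?subrr ?subr0 ?subrr.
- rewrite (eq_bigr (fun i => aact Y (inl i) *m h - h *m aact X (inl i))).
    by rewrite sumrB -mulmx_suml -mulmx_sumr X2 Y2 mul1mx mulmx1 subrr.
  by move=> i _; rewrite ffunE.
- by rewrite (Y3 a).1 -[h *m _ *m _]mulmxA (X3 a).1 addrA subrK subrr.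
- by rewrite (Y3 a).2 -[h *m _ *m _]mulmxA (X3 a).2 addrA subrK subrr.
- by rewrite Y4 -[h *m _ *m _]mulmxA X4 addrA subrK mul0mx mulmx0 subrr.
Qed.

(** The linear maps respecting the vertex decomposition, that is, the direct sum of the spaces
    Hom(X_i, Y_i). Written as a kernel, it shows at once that [d0] sends these maps to cochains
    vanishing on the vertices. *)
Definition graded_maps (k : fieldType) (Q : quiver) (X Y : amod k Q) :
  {vspace 'M[k]_(adim Y, adim X)} :=
  lker (linfun (@vertex_part k Q _) \o linfun (@d0 k Q X Y)).

Definition arrow_cocycles (k : fieldType) (Q : quiver) (X Y : amod k Q) :
  {vspace {ffun qgen Q -> 'M[k]_(adim Y, adim X)}} :=
  (lker (linfun (@d1 k Q X Y)) :&: lker (linfun (@vertex_part k Q _)))%VS.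

(* The idempotents span a separable algebra, so every derivation restricted to
   them is inner: a cocycle is cohomologous to one supported on the arrows. *)
Lemma cocycles_sub (k : fieldType) (Q : quiver) (X Y : amod k Q) :
  is_amod X -> is_amod Y ->
  (lker (linfun (@d1 k Q X Y)) <= arrow_cocycles X Y + limg (linfun (@d0 k Q X Y)))%VS.
Proof.
move=> mX mY; apply/subvP => F; rewrite memv_ker lfunE /= => /eqP F0.
have [Y1 Y2 _ _] := mY.
(* This contracts [F] with the separability element, the sum of the tensors of [e_j] with [e_j]. The
   derivation rule gives [e_i h - h e_i = F(e_i)], so [F - d0 h] vanishes on every vertex. *)
pose h := \sum_(j < qv Q) aact Y (inl j) *m F (inl j).
rewrite -(subrK (d0 h) F) memv_add //; last first.
  by rewrite -lfunE memv_img ?memvf.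
rewrite memv_cap !memv_ker !lfunE /= linearB /= F0 d1_d0 // subrr eqxx /=.
apply/eqP/ffunP => i; rewrite !ffunE mulmx_sumr mulmx_suml.
have hY : \sum_j aact Y (inl i) *m (aact Y (inl j) *m F (inl j))
          = aact Y (inl i) *m F (inl i).
  rewrite (bigD1 i) //= big1 ?addr0 ?mulmxA ?Y1 ?eqxx // => j ji.
  by rewrite mulmxA Y1 eq_sym (negPf ji) mul0mx.
have hX : \sum_j aact Y (inl j) *m F (inl j) *m aact X (inl i)
          = aact Y (inl i) *m F (inl i) - F (inl i).
  rewrite (eq_bigr (fun j => (if j == i then aact Y (inl i) *m F (inl i) else 0)
                             - aact Y (inl j) *m F (inl i))).
    by rewrite sumrB -big_mkcond big_pred1_eq -mulmx_suml Y2 mul1mx.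
  move=> j _; have /ffunP/(_ (inl (j, i))) := F0.
  rewrite !ffunE => /eqP; rewrite subr_eq0 addrC => /eqP /(canRL (addrK _)) E.
  rewrite -mulmxA E mulmxBr mulmxA Y1 eqxx.
  by case: eqP => [->|]; rewrite ?mulmx0.
by rewrite hY hX subKr subrr.
Qed.

(** With [Z = Z0 + B], Ext has dimension [dim Z0 - dim (Z0 :&: B)]. The intersection contains [d0]
    of the graded maps, whose dimension is at least [dim H0 - homdim X Y] by rank-nullity. *)
Lemma extdim_graded_le (k : fieldType) (Q : quiver) (X Y : amod k Q) :
  is_amod X -> is_amod Y ->
  (extdim X Y + \dim (graded_maps X Y) <= \dim (arrow_cocycles X Y) + homdim X Y)%N.
Proof.
move=> mX mY; rewrite /extdim /homdim.
set f0 := linfun (@d0 k Q X Y); set Z := lker _; set B := limg f0.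
set Z0 := arrow_cocycles X Y; set H0 := graded_maps X Y.
have BZ : (B <= Z)%VS.
  apply/subvP => _ /memv_imgP[h _ ->].
  by rewrite memv_ker !lfunE /= d1_d0.
have Zsum : Z = (Z0 + B)%VS.
  apply/eqP; rewrite eqEsubv cocycles_sub //=.
  by rewrite subv_add BZ capvSl.
have HB : (f0 @: H0 <= Z0 :&: B)%VS.
  apply/subvP => _ /memv_imgP[h hH ->]; rewrite !memv_cap.
  have hB : f0 h \in B by rewrite memv_img ?memvf.
  by rewrite (subvP BZ) // hB; move: hH; rewrite !memv_ker comp_lfunE => ->.
(* Here [c] and [i] are the dimensions of the kernel and image of [f0] on [H0], [w] is that of
   [Z0 :&: B], and [e] is [homdim X Y]. The bound [b <= z] makes the truncated subtraction in
   [extdim] exact. *)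
have arith (z b h0 z0 c i w e : nat) : (i <= w)%N -> (b <= z)%N -> (c <= e)%N ->
  (z + w = z0 + b)%N -> (c + i = h0)%N -> (z - b + h0 <= z0 + e)%N by lia.
apply: arith (dimvS HB) (dimvS BZ) (dimvS (capvSr H0 (lker f0))) _
  (limg_ker_dim f0 H0).
by rewrite {1}Zsum dimv_sum_cap.
Qed.

Lemma graded_mapsP (k : fieldType) (Q : quiver) (X Y : amod k Q)
  (h : 'M[k]_(adim Y, adim X)) :
  reflect (forall i, aact Y (inl i) *m h = h *m aact X (inl i))
          (h \in graded_maps X Y).
Proof.
rewrite memv_ker comp_lfunE !lfunE /=; apply: (iffP eqP) => [h0 i|hc].
  by have /ffunP/(_ i) := h0; rewrite !ffunE => /eqP; rewrite subr_eq0 => /eqP.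
by apply/ffunP => i; rewrite !ffunE hc subrr.
Qed.

(** The diagonal blocks [e_i M e_i] consist of graded maps, and they are independent because left
    multiplication by [e_i] kills every block but its own. *)
Lemma dim_graded_ge (k : fieldType) (Q : quiver) (X Y : amod k Q) :
  is_amod X -> is_amod Y ->
  (\sum_(i < qv Q) \rank (aact X (inl i)) * \rank (aact Y (inl i))
     <= \dim (graded_maps X Y))%N.
Proof.
move=> [X1 _ _ _] [Y1 _ _ _].
pose U i := limg (sandwich (aact Y (inl i)) (aact X (inl i))).
rewrite (eq_bigr (fun i => \dim (U i))); last first.
  by move=> i _; rewrite dim_limg_sandwich mulnC.
have /directvP /= <- : directv (\sum_i U i).
  apply/directv_sum_independent => us Uus us0 i _.
  have := congr1 (fun h => aact Y (inl i) *m h) us0.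
  rewrite mulmx0 mulmx_sumr (bigD1 i) //= big1 => [|j ji].
    by have /memv_imgP[E _ ->] := Uus i isT; rewrite sandwichE !mulmxA Y1 eqxx addr0.
  have /memv_imgP[E _ ->] := Uus j isT.
  by rewrite sandwichE !mulmxA Y1 eq_sym (negPf ji) !mul0mx.
apply/dimvS/subv_sumP => i _; apply/subvP => _ /memv_imgP[E _ ->].
rewrite sandwichE; apply/graded_mapsP => j; rewrite -!mulmxA X1 !mulmxA Y1 eq_sym.
by case: eqP => [->|_]; rewrite ?mul0mx ?mulmx0.
Qed.

Definition single_arrow (k : fieldType) (Q : quiver) (V : lmodType k)
  (a : 'I_(qa Q)) (v : V) : {ffun qgen Q -> V} :=
  [ffun g => if g == inr a then v else 0].

Fact single_arrow_is_linear (k : fieldType) (Q : quiver) (V : lmodType k)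
  (a : 'I_(qa Q)) : linear (@single_arrow k Q V a).
Proof.
move=> c v w; apply/ffunP => g; rewrite !ffunE.
by case: ifP => _; rewrite ?scaler0 ?addr0.
Qed.

HB.instance Definition _ (k : fieldType) (Q : quiver) (V : lmodType k)
  (a : 'I_(qa Q)) :=
  GRing.isLinear.Build k _ _ _ (@single_arrow k Q V a) (@single_arrow_is_linear k Q V a).

Lemma arrow_cocyclesP (k : fieldType) (Q : quiver) (X Y : amod k Q)
  (F : {ffun qgen Q -> 'M[k]_(adim Y, adim X)}) :
  reflect [/\ forall i, F (inl i) = 0,
              forall a, aact Y (inl (qt a)) *m F (inr a) = F (inr a),
              forall a, F (inr a) *m aact X (inl (qs a)) = F (inr a)
            & forall a b, aact Y (inr b) *m F (inr a) + F (inr b) *m aact X (inr a) = 0]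
          (F \in arrow_cocycles X Y).
Proof.
rewrite memv_cap !memv_ker !lfunE /=; apply: (iffP andP) => [[/eqP F1 /eqP F0]|].
  have Fv i : F (inl i) = 0 by have /ffunP/(_ i) := F0; rewrite !ffunE.
  split=> // [a|a|a b].
  - have /ffunP/(_ (inr (inr (inl (a, true))))) := F1.
    by rewrite !ffunE Fv mul0mx addr0 => /eqP; rewrite subr_eq0 => /eqP.
  - have /ffunP/(_ (inr (inr (inl (a, false))))) := F1.
    by rewrite !ffunE Fv mulmx0 add0r => /eqP; rewrite subr_eq0 => /eqP.
  - by have /ffunP/(_ (inr (inr (inr (a, b))))) := F1; rewrite !ffunE.
move=> [Fv Ft Fs Fab]; split; apply/eqP/ffunP; last by move=> i; rewrite !ffunE.
case=> [[i j]|[u|[[a []]|[a b]]]]; rewrite !ffunE ?Fv ?mul0mx ?mulmx0.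
- by case: ifP; rewrite ?Fv ?subr0 addr0.
- by apply: big1.
- by rewrite Ft addr0 subrr.
- by rewrite Fs add0r subrr.
- exact: Fab.
Qed.

(** The value of a cocycle on an arrow [a] lies in the block from the vertex space of X at [qs a] to
    that of Y at [qt a], and the cocycle is the sum of its values on single arrows. The predicate
    [P] discards arrows on which all cocycles vanish. *)
Lemma dim_arrow_cocycles_le (k : fieldType) (Q : quiver) (X Y : amod k Q)
  (P : pred 'I_(qa Q)) :
  (forall F, F \in arrow_cocycles X Y -> forall a, F (inr a) != 0 -> P a) ->
  (\dim (arrow_cocycles X Y) <=
   \sum_(a | P a) \rank (aact X (inl (qs a))) * \rank (aact Y (inl (qt a))))%N.
Proof.
move=> HP.
pose U a := (linfun (single_arrow a)
  @: limg (sandwich (aact Y (inl (qt a))) (aact X (inl (qs a)))))%VS.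
have sub : (arrow_cocycles X Y <= \sum_(a | P a) U a)%VS.
  apply/subvP => F FZ; have /arrow_cocyclesP[Fv Ft Fs _] := FZ.
  apply/memv_sumP; exists (fun a => single_arrow a (F (inr a))).
    move=> a _; rewrite -lfunE memv_img //; apply/memv_imgP.
    by exists (F (inr a)); rewrite ?memvf // sandwichE Ft Fs.
  apply/ffunP => -[i|a]; rewrite sum_ffunE.
    by rewrite Fv big1 // => a _; rewrite ffunE.
  rewrite big_mkcond (bigD1 a) //= big1 ?addr0 => [|b ba].
    by rewrite ffunE eqxx; case: ifP => //; apply: contraFeq; exact: HP.
  by rewrite ffunE -[inr a == inr b]/(a == b) eq_sym (negPf ba); case: ifP.
apply: leq_trans (dimvS sub) _; apply: leq_trans (dimv_sum_leqif _) _.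
apply: leq_sum => a _; rewrite mulnC -dim_limg_sandwich.
by rewrite -[leqRHS](limg_ker_dim (linfun (single_arrow a))) leq_addl.
Qed.

(** * Tops, socles and bricks *)

(** One construction serves tops and socles. A row vector is a functional on X; being fixed by [e_i]
    and killed by all arrows makes it a homomorphism to the simple module at i. Transposed matrices
    give the dual notion. *)
Definition joint_kernel (k : fieldType) (n q : nat) (e : 'M[k]_n)
  (x : 'I_q -> 'M[k]_n) : 'M[k]_n :=
  (kermx (1%:M - e) :&: \bigcap_a kermx (x a))%MS.

Lemma joint_kernelP (k : fieldType) (n q : nat) (e : 'M[k]_n)
  (x : 'I_q -> 'M[k]_n) :
  reflect (exists u : 'rV[k]_n, [/\ u != 0, u *m e = u & forall a, u *m x a = 0])
          (joint_kernel e x != 0).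
Proof.
apply: (iffP rowV0Pn) => [[u]|[u [u0 ue ux]]].
  rewrite sub_capmx sub_kermx mulmxBr mulmx1 subr_eq0 => /andP[/eqP ue ux] u0.
  exists u; split=> // a; apply/eqP; rewrite -sub_kermx.
  by move/sub_bigcapmxP: ux; apply.
exists u => //; rewrite sub_capmx sub_kermx mulmxBr mulmx1 ue subrr eqxx /=.
by apply/sub_bigcapmxP => a _; rewrite sub_kermx ux.
Qed.

(* [in_top X i] and [in_socle X i] say that the simple module at vertex i is a
   quotient, respectively a submodule, of X. *)
Definition in_top (k : fieldType) (Q : quiver) (X : amod k Q) (i : 'I_(qv Q)) :=
  joint_kernel (aact X (inl i)) (fun a => aact X (inr a)) != 0.

Definition in_socle (k : fieldType) (Q : quiver) (X : amod k Q) (i : 'I_(qv Q)) :=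
  joint_kernel (aact X (inl i))^T (fun a => (aact X (inr a))^T) != 0.

Lemma in_topP (k : fieldType) (Q : quiver) (X : amod k Q) (i : 'I_(qv Q)) :
  reflect (exists u : 'rV[k]_(adim X), [/\ u != 0, u *m aact X (inl i) = u
             & forall a, u *m aact X (inr a) = 0])
          (in_top X i).
Proof. exact: joint_kernelP. Qed.

Lemma in_socleP (k : fieldType) (Q : quiver) (X : amod k Q) (i : 'I_(qv Q)) :
  reflect (exists u : 'cV[k]_(adim X), [/\ u != 0, aact X (inl i) *m u = u
             & forall a, aact X (inr a) *m u = 0])
          (in_socle X i).
Proof.
have tr0 m n (B : 'M[k]_(m, n)) : (B^T == 0) = (B == 0).
  by rewrite -(inj_eq trmx_inj) trmxK trmx0.
apply: (iffP (joint_kernelP _ _)) => -[u [u0 ue ux]]; exists u^T.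
  split=> [||a]; first by rewrite tr0.
    by apply: trmx_inj; rewrite trmx_mul trmxK.
  by apply: trmx_inj; rewrite trmx_mul trmxK trmx0.
by split=> [||a]; rewrite -?trmx_mul ?ue ?ux ?trmx0 ?tr0.
Qed.

Lemma in_top_mx (k : fieldType) (Q : quiver) (X : amod k Q) (i : 'I_(qv Q))
  (m : nat) (A : 'M[k]_(m, adim X)) :
  A != 0 -> A *m aact X (inl i) = A -> (forall a, A *m aact X (inr a) = 0) ->
  in_top X i.
Proof.
move=> /eqP A0 Ae Ax.
have [r r0] : exists r, row r A != 0.
  apply/existsP; rewrite -[X in is_true X]negbK negb_exists; apply/negP => /forallP Z.
  by apply: A0; apply/row_matrixP => r; rewrite row0; apply/eqP; move: (Z r); rewrite negbK.
apply/in_topP; exists (row r A); split=> // [|a]; rewrite -row_mul ?Ae ?Ax //.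
exact: row0.
Qed.

Lemma in_socle_mx (k : fieldType) (Q : quiver) (X : amod k Q) (i : 'I_(qv Q))
  (m : nat) (A : 'M[k]_(adim X, m)) :
  A != 0 -> aact X (inl i) *m A = A -> (forall a, aact X (inr a) *m A = 0) ->
  in_socle X i.
Proof.
move=> /eqP A0 Ae Ax.
have [r r0] : exists r, col r A != 0.
  apply/existsP; rewrite -[X in is_true X]negbK negb_exists; apply/negP => /forallP Z.
  apply: A0; apply/trmx_inj/row_matrixP => r; rewrite -tr_col trmx0 row0 -trmx0.
  by congr trmx; apply/eqP; move: (Z r); rewrite negbK.
apply/in_socleP; exists (col r A); split=> // [|a].
  by rewrite colE mulmxA Ae.
by rewrite colE mulmxA Ax mul0mx.
Qed.

Lemma mem_homs (k : fieldType) (Q : quiver) (X Y : amod k Q)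
  (h : 'M[k]_(adim Y, adim X)) :
  (forall g, aact Y g *m h = h *m aact X g) -> h \in lker (linfun (@d0 k Q X Y)).
Proof.
move=> hc; rewrite memv_ker lfunE; apply/eqP/ffunP => g.
by rewrite !ffunE hc subrr.
Qed.

Lemma mulmx_col_row_neq0 (k : fieldType) (m n : nat) (u : 'cV[k]_m) (v : 'rV[k]_n) :
  u != 0 -> v != 0 -> u *m v != 0.
Proof.
rewrite -mxrank_eq0 => u0 v0; rewrite -mxrank_eq0 mxrankMfree ?mxrank_eq0.
  by rewrite -mxrank_eq0.
by rewrite /row_free rank_rV v0.
Qed.

(** The product [u *m v] is the composite of the map [v] from X to the simple module at i with the
    map [u] from that simple module to Y. *)
Lemma top_socle_mem_homs (k : fieldType) (Q : quiver) (X Y : amod k Q)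
  (i : 'I_(qv Q)) (u : 'cV[k]_(adim Y)) (v : 'rV[k]_(adim X)) :
  is_amod X -> is_amod Y ->
  aact Y (inl i) *m u = u -> (forall a, aact Y (inr a) *m u = 0) ->
  v *m aact X (inl i) = v -> (forall a, v *m aact X (inr a) = 0) ->
  u *m v \in lker (linfun (@d0 k Q X Y)).
Proof.
move=> [X1 _ _ _] [Y1 _ _ _] ue ux ve vx; apply: mem_homs => -[j|a]; last first.
  by rewrite mulmxA ux mul0mx -mulmxA vx mulmx0.
rewrite -{1}ue -{2}ve !mulmxA Y1 -!mulmxA X1 eq_sym.
case: eqP => [<-|_]; last by rewrite mul0mx !mulmx0.
by rewrite ve mulmxA ue.
Qed.

Lemma homdim0_disjoint (k : fieldType) (Q : quiver) (X Y : amod k Q) :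
  is_amod X -> is_amod Y -> homdim X Y = 0 ->
  forall i, ~~ (in_top X i && in_socle Y i).
Proof.
move=> mX mY h0 i; apply/negP => /andP[/in_topP[v [v0 ve vx]] /in_socleP[u [u0 ue ux]]].
have := top_socle_mem_homs mX mY ue ux ve vx.
have /eqP := h0; rewrite dimv_eq0 => /eqP ->; rewrite memv0.
by rewrite (negPf (mulmx_col_row_neq0 u0 v0)).
Qed.

Lemma brick_endo_scalar (k : fieldType) (Q : quiver) (X : amod k Q)
  (h : 'M[k]_(adim X)) :
  (0 < adim X)%N -> is_brick X -> h \in lker (linfun (@d0 k Q X X)) ->
  exists c, h = c%:M.
Proof.
move=> d0X bX hh.
have one : 1%:M \in lker (linfun (@d0 k Q X X)).
  by apply: mem_homs => g; rewrite mul1mx mulmx1.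
have one0 : (1%:M : 'M[k]_(adim X)) != 0.
  by rewrite -mxrank_eq0 mxrank1 -lt0n.
have /eqP E : (<[1%:M : 'M[k]_(adim X)]> == lker (linfun (@d0 k Q X X)))%VS.
  by rewrite eqEdim -memvE one dim_vline one0 [X in (X <= _)%N]bX.
by move: hh; rewrite -E => /vlineP[c ->]; exists c; rewrite scalemx1.
Qed.

(** The endomorphism of X through the simple module at i has rank one. In a brick it is a nonzero
    scalar, hence of full rank, so X has dimension one. *)
Lemma brick_top_socle_simple (k : fieldType) (Q : quiver) (X : amod k Q)
  (i : 'I_(qv Q)) :
  is_amod X -> (0 < adim X)%N -> is_brick X -> in_top X i -> in_socle X i ->
  [/\ adim X = 1, aact X (inl i) = 1%:M & forall a, aact X (inr a) = 0].
Proof.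
move=> mX dX bX /in_topP[v [v0 ve vx]] /in_socleP[u [u0 ue ux]].
have [c uv] := brick_endo_scalar dX bX (top_socle_mem_homs mX mX ue ux ve vx).
have dX1 : adim X = 1.
  apply/eqP; rewrite eqn_leq dX andbT.
  have c0 : c != 0.
    by apply: contraNneq (mulmx_col_row_neq0 u0 v0) => c0; rewrite uv c0 raddf0.
  rewrite -{1}(mxrank1 k (adim X)) -(mxrank_scale_nz _ c0) scalemx1 -uv.
  exact: leq_trans (mxrankM_maxr _ _) (rank_leq_row _).
have /row_fullP[D Dv] : row_full v by rewrite /row_full rank_rV v0 dX1.
split=> // [|a]; first by rewrite -[LHS]mul1mx -Dv -mulmxA ve.
by rewrite -[LHS]mul1mx -Dv -mulmxA vx mulmx0.
Qed.

Lemma arrow_mul_neq (k : fieldType) (Q : quiver) (X : amod k Q) (a : 'I_(qa Q))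
  (i : 'I_(qv Q)) :
  is_amod X -> aact X (inr a) *m aact X (inl i) != 0 -> i = qs a.
Proof.
move=> [X1 _ X3 _]; have [->//|ne] := eqVneq i (qs a).
by rewrite -(X3 a).2 -mulmxA X1 [_ == i]eq_sym (negPf ne) mulmx0 eqxx.
Qed.

Lemma arrow_in_top (k : fieldType) (Q : quiver) (X : amod k Q) (a : 'I_(qa Q)) :
  is_amod X -> aact X (inr a) != 0 -> in_top X (qs a).
Proof.
move=> [_ _ X3 X4] a0; apply: (in_top_mx a0) => [|b]; last exact: X4.
by rewrite (X3 a).2.
Qed.

Lemma arrow_in_socle (k : fieldType) (Q : quiver) (X : amod k Q) (a : 'I_(qa Q)) :
  is_amod X -> aact X (inr a) != 0 -> in_socle X (qt a).
Proof.
move=> [_ _ X3 X4] a0; apply: (in_socle_mx a0) => [|b]; last exact: X4.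
by rewrite (X3 a).1.
Qed.

(** If some arrow acts nontrivially on the space at i, then i is its source and lies in the top
    because products of arrows vanish. Otherwise all arrows kill that space, which then lies in the
    socle. *)
Lemma in_top_or_socle (k : fieldType) (Q : quiver) (X : amod k Q) (i : 'I_(qv Q)) :
  is_amod X -> (0 < \rank (aact X (inl i)))%N = in_top X i || in_socle X i.
Proof.
move=> mX; have [X1 _ X3 _] := mX; rewrite lt0n mxrank_eq0; apply/idP/idP => [e0|].
  have ee : aact X (inl i) *m aact X (inl i) = aact X (inl i) by rewrite X1 eqxx.
  have [/existsP[a a0]|] := boolP [exists a, aact X (inr a) *m aact X (inl i) != 0].
    rewrite (arrow_mul_neq mX a0) arrow_in_top //.
    by apply: contraNneq a0 => ->; rewrite mul0mx.
  rewrite negb_exists => /forallP z; apply/orP; right.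
  by apply: (in_socle_mx e0 ee) => a; apply/eqP; move: (z a); rewrite negbK.
by case/orP => [/in_topP|/in_socleP] [u [u0 ue _]];
  apply: contraNneq u0 => e0; rewrite -ue e0 ?mulmx0 ?mul0mx.
Qed.

Lemma top_socle_nonempty (k : fieldType) (Q : quiver) (X : amod k Q) :
  is_amod X -> (0 < adim X)%N ->
  (exists i, in_top X i) /\ (exists i, in_socle X i).
Proof.
move=> mX dX; have [X1 X2 X3 X4] := mX.
have [/existsP[a a0]|] := boolP [exists a, aact X (inr a) != 0].
  by split; [exists (qs a); exact: arrow_in_top|exists (qt a); exact: arrow_in_socle].
rewrite negb_exists => /forallP z.
have {}z a : aact X (inr a) = 0 by apply/eqP; move: (z a); rewrite negbK.
have [i e0] : exists i, aact X (inl i) != 0.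
  apply/existsP; rewrite -[X in is_true X]negbK negb_exists; apply/negP => /forallP Z.
  have := mxrank1 k (adim X); rewrite -X2 big1 ?mxrank0; first by lia.
  by move=> i _; apply/eqP; move: (Z i); rewrite negbK.
have ee : aact X (inl i) *m aact X (inl i) = aact X (inl i) by rewrite X1 eqxx.
split; exists i.
  by apply: (in_top_mx e0 ee) => a; rewrite z mulmx0.
by apply: (in_socle_mx e0 ee) => a; rewrite z mul0mx.
Qed.

(** The relation for a path of length two reads [Y_b F_c + F_b X_c = 0]. If one term were nonzero,
    both would be, and the vertex [qs b = qt c] would lie in the top of Y and the socle of X. So
    both terms vanish: each [F_a] kills the radical of X and is killed by the arrows of Y. *)
Lemma cocycle_support (k : fieldType) (Q : quiver) (X Y : amod k Q) :
  is_amod X -> is_amod Y ->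
  (forall i, ~~ (in_top Y i && in_socle X i)) ->
  forall F, F \in arrow_cocycles X Y -> forall a, F (inr a) != 0 ->
    in_top X (qs a) && in_socle Y (qt a).
Proof.
move=> mX mY disj F /arrow_cocyclesP[_ Ft Fs Fr] a Fa0.
have [_ _ X3 X4] := mX; have [_ _ Y3 Y4] := mY.
have YF b c : aact Y (inr b) *m F (inr c) = 0.
  apply/eqP/negPn/negP => nz.
  have nz' : F (inr b) *m aact X (inr c) != 0.
    by apply: contraNneq nz => z; have := Fr c b; rewrite z addr0 => ->.
  have E : qs b = qt c.
    have [X1 _ _ _] := mX; apply/eqP; apply: contraNT nz' => /negPf E.
    by rewrite -Fs -(X3 c).1 mulmxA -[F _ *m _ *m _]mulmxA X1 E mulmx0 mul0mx.
  have /negP := disj (qs b); apply; rewrite arrow_in_top //=; last first.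
    by apply: contraNneq nz => ->; rewrite mul0mx.
  by rewrite E arrow_in_socle //; apply: contraNneq nz' => ->; rewrite mulmx0.
apply/andP; split.
  apply: (in_top_mx Fa0 (Fs a)) => c.
  by have := Fr c a; rewrite YF add0r.
exact: (in_socle_mx Fa0 (Ft a)).
Qed.

(** * Levels on the path with three vertices *)

(** Boolean quantifiers turn the finite check of [level_lt] into the evaluation of one closed
    boolean. *)
Definition all_bool (P : pred bool) := P true && P false.

Lemma all_boolP (P : pred bool) : all_bool P -> forall b, P b.
Proof. by case/andP => Pt Pf []. Qed.

Definition triple := (bool * bool * bool)%type.

Definition all_triple (P : pred triple) :=
  all_bool (fun a => all_bool (fun b => all_bool (fun c => P (a, b, c)))).

Lemma all_tripleP (P : pred triple) : all_triple P -> forall x, P x.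
Proof.
by move=> H [[a b] c]; have := all_boolP (all_boolP (all_boolP H a) b) c.
Qed.

Definition tcount (x : triple) : nat := x.1.1 + x.1.2 + x.2.

Definition tand (x y : triple) : triple :=
  (x.1.1 && y.1.1, x.1.2 && y.1.2, x.2 && y.2).

Definition tor (x y : triple) : triple :=
  (x.1.1 || y.1.1, x.1.2 || y.1.2, x.2 || y.2).

(** The sum of [t_i * s_j] over the non-loop arrows from i to j of a path on the vertices 0, 1, 2,
    where [nij] counts the arrows from i to j. *)
Definition arrow_form (n01 n10 n12 n21 : nat) (t0 t1 t2 s0 s1 s2 : nat) : nat :=
  (n01 * (t0 * s1) + n10 * (t1 * s0) + (n12 * (t1 * s2) + n21 * (t2 * s1)))%N.

Definition bool_form (n01 n10 n12 n21 : bool) (t s : triple) : nat :=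
  arrow_form n01 n10 n12 n21 t.1.1 t.1.2 t.2 s.1.1 s.1.2 s.2.

(* Vertex 0 sits at 2 so that the truncated subtractions are exact: the height
   increases by one along each arrow. *)
Definition height (n01 n10 n12 n21 : bool) (x : triple) : nat :=
  let h1 := (2 + n01 - n10)%N in
  maxn (x.1.1 * 2) (maxn (x.1.2 * h1) (x.2 * (h1 + n12 - n21))).

Definition level (n01 n10 n12 n21 : bool) (t s : triple) : nat :=
  (height n01 n10 n12 n21 t + height n01 n10 n12 n21 s)%N.

(** Conditions on the supports [t] of the top and [s] of the socle of a brick. The first disjunct is
    the simple case. In the second, top and socle are disjoint and nonempty, and the last bound is
    the Euler inequality for Ext(X, X) when all vertex spaces have dimension at most one. *)
Definition brick_profile (n01 n10 n12 n21 : bool) (t s : triple) : bool :=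
  ((t == s) && (tcount t == 1)) ||
  [&& tcount (tand t s) == 0, tcount t != 0, tcount s != 0
    & tcount (tor t s) <= 1 + bool_form n01 n10 n12 n21 t s]%N.

(** The last hypothesis is what a nonzero Ext from the first brick to the second yields, and the two
    disjointness conditions come from the vanishing of Hom in both directions. The claim is decided
    by evaluating all 2^16 combinations of orientation bits and supports. *)
Lemma level_lt (n01 n10 n12 n21 : bool) (t s t' s' : triple) :
  ~~ (n01 && n10) -> ~~ (n12 && n21) ->
  brick_profile n01 n10 n12 n21 t s -> brick_profile n01 n10 n12 n21 t' s' ->
  tcount (tand t s') = 0 -> tcount (tand t' s) = 0 ->
  (tcount (tand (tor t s) (tor t' s')) < bool_form n01 n10 n12 n21 t s')%N ->
  (level n01 n10 n12 n21 t s < level n01 n10 n12 n21 t' s')%N.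
Proof.
pose test n01 n10 n12 n21 t s t' s' :=
  ~~ (n01 && n10) ==> ~~ (n12 && n21) ==> brick_profile n01 n10 n12 n21 t s ==>
  brick_profile n01 n10 n12 n21 t' s' ==>
  (tcount (tand t s') == 0) ==> (tcount (tand t' s) == 0) ==>
  (tcount (tand (tor t s) (tor t' s')) < bool_form n01 n10 n12 n21 t s')%N ==>
  (level n01 n10 n12 n21 t s < level n01 n10 n12 n21 t' s')%N.
have : all_bool (fun n01 => all_bool (fun n10 => all_bool (fun n12 => all_bool
  (fun n21 => all_triple (fun t => all_triple (fun s =>
    all_triple (fun t' => all_triple (test n01 n10 n12 n21 t s t')))))))).
  by vm_compute.
move=> /all_boolP/(_ n01)/all_boolP/(_ n10)/all_boolP/(_ n12)/all_boolP/(_ n21).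
move=> /all_tripleP/(_ t)/all_tripleP/(_ s)/all_tripleP/(_ t')/all_tripleP/(_ s').
rewrite /test => T o1 o2 p p' /eqP d /eqP d' f.
by move: T; rewrite o1 o2 p p' d d' f.
Qed.

(** Padding by zero treats one, two and three vertices by the same formulas. *)
Definition extend0 (n : nat) (f : 'I_n -> nat) (i : nat) : nat :=
  oapp f 0%N (insub i).

Lemma extend0_val (n : nat) (f : 'I_n -> nat) (i : 'I_n) : extend0 f i = f i.
Proof. by rewrite /extend0 valK. Qed.

Lemma sum_extend0 (n : nat) (f : 'I_n -> nat) : (n <= 3)%N ->
  (\sum_j f j = extend0 f 0 + extend0 f 1 + extend0 f 2)%N.
Proof.
move=> n3; under eq_bigr => j _ do rewrite -extend0_val.
rewrite (big_ord_widen 3 (extend0 f) n3) big_mkcond /=.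
rewrite (eq_bigr (fun i : 'I_3 => extend0 f i)) => [|i _].
  by rewrite !big_ord_recl big_ord0 /= addn0 addnA.
by case: ifPn => // ni; rewrite /extend0 insubN.
Qed.

Definition support3 (n : nat) (f : 'I_n -> nat) : triple :=
  (extend0 f 0 != 0, extend0 f 1 != 0, extend0 f 2 != 0)%N.

Lemma support3_max (n : nat) (f g : 'I_n -> nat) :
  support3 (fun i => maxn (f i) (g i)) = tor (support3 f) (support3 g).
Proof.
have E i : (extend0 (fun i => maxn (f i) (g i)) i != 0)%N
    = (extend0 f i != 0)%N || (extend0 g i != 0)%N.
  by rewrite /extend0; case: insub => //= j; lia.
by rewrite /support3 !E.
Qed.

Lemma extend0_thin (n : nat) (f : 'I_n -> nat) (i : nat) :
  (forall j, f j <= 1)%N -> extend0 f i = (extend0 f i != 0)%N.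
Proof. by rewrite /extend0; case: insub => //= j /(_ j); lia. Qed.

Lemma sum_tcount (n : nat) (f g : 'I_n -> nat) : (n <= 3)%N ->
  (forall j, f j <= 1)%N -> (forall j, g j <= 1)%N ->
  (\sum_j f j * g j = tcount (tand (support3 f) (support3 g)))%N.
Proof.
move=> n3 f1 g1; rewrite sum_extend0 //.
have E i : extend0 (fun j => f j * g j)%N i
    = ((extend0 f i != 0) && (extend0 g i != 0))%N.
  by rewrite -mulnb -!extend0_thin // /extend0; case: insub.
by rewrite !E.
Qed.

(** Indexing by natural numbers gives a meaning, namely false, to vertices that a quiver with fewer
    than three vertices does not have. *)
Definition has_arrow (Q : quiver) (i j : nat) : bool :=
  [exists a : 'I_(qa Q), (qs a == i :> nat) && (qt a == j :> nat)].

Definition path_shaped (Q : quiver) : Prop :=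
  forall i j : 'I_(qv Q), i != j ->
    #|[pred a | ((qs a == i) && (qt a == j)) || ((qs a == j) && (qt a == i))]|
    = (if (i.+1 == j) || (j.+1 == i) then 1 else 0)%N.

Lemma has_arrow_adjacent (Q : quiver) (i j : nat) :
  path_shaped Q -> i != j -> has_arrow Q i j -> (i.+1 == j) || (j.+1 == i).
Proof.
move=> pQ ij /existsP[a /andP[/eqP ai /eqP aj]].
have ne : qs a != qt a by rewrite -(inj_eq val_inj) /= ai aj.
have := pQ _ _ ne; rewrite ai aj; case: ifP => // _ /card0_eq/(_ a).
by rewrite !inE !eqxx.
Qed.

Lemma arrow_unique (Q : quiver) (a b : 'I_(qa Q)) :
  path_shaped Q -> qs a != qt a ->
  ((qs b == qs a) && (qt b == qt a)) || ((qs b == qt a) && (qt b == qs a)) ->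
  b = a.
Proof.
move=> pQ ne hb.
have /card_le1_eqP : (#|[pred c | ((qs c == qs a) && (qt c == qt a))
                                || ((qs c == qt a) && (qt c == qs a))]| <= 1)%N.
  by rewrite pQ //; case: ifP.
by apply; rewrite !inE ?eqxx.
Qed.

Lemma has_arrow_asym (Q : quiver) (i j : nat) :
  path_shaped Q -> i != j -> ~~ (has_arrow Q i j && has_arrow Q j i).
Proof.
move=> pQ ij; apply/negP => /andP[/existsP[a /andP[/eqP ai /eqP aj]]].
move=> /existsP[b /andP[/eqP bj /eqP bi]].
have ne : qs a != qt a by rewrite -(inj_eq val_inj) /= ai aj.
have ba : b = a.
  by apply: arrow_unique => //; rewrite -!(inj_eq val_inj) /= ai aj bi bj !eqxx orbT.
by move: ij; rewrite -aj -bi ba eqxx.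
Qed.

Lemma card_arrows (Q : quiver) (i j : nat) : path_shaped Q -> i != j ->
  #|[pred a : 'I_(qa Q) | (qs a == i :> nat) && (qt a == j :> nat)]| = has_arrow Q i j.
Proof.
move=> pQ ij; have [/existsP[a /andP[/eqP ai /eqP aj]]|] := boolP (has_arrow Q i j).
  have ne : qs a != qt a by rewrite -(inj_eq val_inj) /= ai aj.
  apply/eqP; rewrite eqn_leq; apply/andP; split; last first.
    by apply/card_gt0P; exists a; rewrite !inE ai aj !eqxx.
  apply/card_le1_eqP => b c; rewrite !inE => /andP[/eqP bi /eqP bj] /andP[/eqP ci /eqP cj].
  have -> : b = a.
    by apply: arrow_unique => //; rewrite -!(inj_eq val_inj) /= ai aj bi bj !eqxx.
  have -> // : c = a.
  by apply: arrow_unique => //; rewrite -!(inj_eq val_inj) /= ai aj ci cj !eqxx.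
by move=> /existsPn na; apply: eq_card0 => a; rewrite !inE; exact/negbTE.
Qed.

(** Arrows are grouped by source and target. The hypothesis on [f i * g i] removes the loops,
    vertices 0 and 2 are not adjacent, and every other ordered pair carries at most one arrow. *)
Lemma sum_arrows (Q : quiver) (f g : 'I_(qv Q) -> nat) :
  (qv Q <= 3)%N -> path_shaped Q -> (forall i, f i * g i = 0)%N ->
  (\sum_(a < qa Q) f (qs a) * g (qt a) =
   arrow_form (has_arrow Q 0 1) (has_arrow Q 1 0) (has_arrow Q 1 2) (has_arrow Q 2 1)
     (extend0 f 0) (extend0 f 1) (extend0 f 2)
     (extend0 g 0) (extend0 g 1) (extend0 g 2))%N.
Proof.
move=> n3 pQ fg0.
have fg0' i : (extend0 f i * extend0 g i = 0)%N.
  by rewrite /extend0; case: insub => /=.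
have far i j : i != j -> ~~ ((i.+1 == j) || (j.+1 == i)) -> has_arrow Q i j = false.
  by move=> ij; apply: contraNF; apply: has_arrow_adjacent.
transitivity (\sum_(i < 3) \sum_(j < 3)
    #|[pred a : 'I_(qa Q) | (qs a == i :> nat) && (qt a == j :> nat)]|
      * (extend0 f i * extend0 g j))%N.
  transitivity (\sum_(i < 3) \sum_(j < 3)
      \sum_(a | (qs a == i :> nat) && (qt a == j :> nat)) f (qs a) * g (qt a))%N.
    rewrite (partition_big (fun a => widen_ord n3 (qs a)) xpredT) //=.
    apply: eq_bigr => i _.
    rewrite (partition_big (fun a => widen_ord n3 (qt a)) xpredT) //=.
  apply: eq_bigr => i _; apply: eq_bigr => j _.
  rewrite -sum_nat_const; apply: eq_bigr => a /andP[/eqP <- /eqP <-].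
  by rewrite !extend0_val.
rewrite !big_ord_recl !big_ord0 /= /bump /= !addn0 !fg0' !muln0 !add0n !addn0.
rewrite !card_arrows // !(far 0 2) // !(far 2 0) //=.
by rewrite /arrow_form -[(1 + 1)%N]/2%N !mul0n !addn0 !add0n !addnA.
Qed.

(** * Bricks over path-shaped quivers *)

Definition vdim (k : fieldType) (Q : quiver) (X : amod k Q) (i : 'I_(qv Q)) : nat :=
  \rank (aact X (inl i)).

(** When no vertex lies in both top and socle, the radical vanishes at each vertex of the top, so
    the whole vertex space counts and this is the multiplicity of the simple module in the top. The
    same holds for simple X; [socdim] is dual. *)
Definition topdim (k : fieldType) (Q : quiver) (X : amod k Q) (i : 'I_(qv Q)) : nat :=
  if in_top X i then vdim X i else 0%N.

Definition socdim (k : fieldType) (Q : quiver) (X : amod k Q) (i : 'I_(qv Q)) : nat :=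
  if in_socle X i then vdim X i else 0%N.

Lemma vdim_max (k : fieldType) (Q : quiver) (X : amod k Q) (i : 'I_(qv Q)) :
  is_amod X -> vdim X i = maxn (topdim X i) (socdim X i).
Proof.
move=> mX; have := in_top_or_socle i mX; rewrite /topdim /socdim /vdim.
by case: in_top; case: in_socle => /=; lia.
Qed.

Lemma topdim_gt0 (k : fieldType) (Q : quiver) (X : amod k Q) (i : 'I_(qv Q)) :
  is_amod X -> (0 < topdim X i)%N = in_top X i.
Proof.
by move=> mX; have := in_top_or_socle i mX; rewrite /topdim /vdim; case: in_top.
Qed.

Lemma socdim_gt0 (k : fieldType) (Q : quiver) (X : amod k Q) (i : 'I_(qv Q)) :
  is_amod X -> (0 < socdim X i)%N = in_socle X i.
Proof.
move=> mX; have := in_top_or_socle i mX; rewrite /socdim /vdim.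
by case: in_socle; rewrite ?orbT.
Qed.

Lemma topdim_socdim_disjoint (k : fieldType) (Q : quiver) (X Y : amod k Q) :
  (forall i, ~~ (in_top X i && in_socle Y i)) ->
  forall i, (topdim X i * socdim Y i = 0)%N.
Proof.
move=> disj i; have := disj i; rewrite /topdim /socdim.
by case: in_top; case: in_socle; rewrite ?muln0.
Qed.

(** The lower bound on graded maps and the upper bound on arrow cocycles are inserted into
    [extdim_graded_le]. By [cocycle_support] only arrows from the top of X to the socle of Y count,
    and on the others the summand is zero. *)
Lemma extdim_euler_le (k : fieldType) (Q : quiver) (X Y : amod k Q) :
  is_amod X -> is_amod Y -> (forall i, ~~ (in_top Y i && in_socle X i)) ->
  (extdim X Y + \sum_i vdim X i * vdim Y i
     <= \sum_(a < qa Q) topdim X (qs a) * socdim Y (qt a) + homdim X Y)%N.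
Proof.
move=> mX mY disj.
have Zle := dim_arrow_cocycles_le (cocycle_support mX mY disj).
apply: leq_trans (leq_add (leqnn _) (dim_graded_ge mX mY)) _.
apply: leq_trans (extdim_graded_le mX mY) _; rewrite leq_add2r.
apply: leq_trans Zle _; rewrite big_mkcond /=; apply: leq_sum => a _.
by rewrite /topdim /socdim; case: in_top; case: in_socle.
Qed.

Definition simple_at (k : fieldType) (Q : quiver) (X : amod k Q) (i : 'I_(qv Q)) :=
  [/\ adim X = 1, aact X (inl i) = 1%:M & forall a, aact X (inr a) = 0].

Lemma brick_cases (k : fieldType) (Q : quiver) (X : amod k Q) :
  is_amod X -> (0 < adim X)%N -> is_brick X ->
  (exists i, simple_at X i) \/ (forall i, ~~ (in_top X i && in_socle X i)).
Proof.
move=> mX dX bX.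
have [/existsP[i /andP[ti si]]|/existsPn] :=
  boolP [exists i, in_top X i && in_socle X i]; last by right.
by left; exists i; apply: brick_top_socle_simple.
Qed.

Lemma simple_dims (k : fieldType) (Q : quiver) (X : amod k Q) (i : 'I_(qv Q)) :
  is_amod X -> simple_at X i ->
  forall j, [/\ vdim X j = (j == i), topdim X j = (j == i) & socdim X j = (j == i)].
Proof.
move=> mX [dX ei xa]; have [X1 _ _ _] := mX => j.
have vj : vdim X j = (j == i).
  rewrite /vdim -[aact X (inl j)]mulmx1 -ei X1; case: eqP => [->|_]; last by rewrite mxrank0.
  by rewrite ei mxrank1 dX.
rewrite /topdim /socdim vj; case: eqP vj => [->|_] vj; last by split=> //; case: ifP.
have e0 : aact X (inl i) != 0 by rewrite -mxrank_eq0 [\rank _]vj.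
have -> : in_top X i.
  by apply: (in_top_mx e0) => [|a]; rewrite ?X1 ?eqxx // xa mulmx0.
have -> // : in_socle X i.
by apply: (in_socle_mx e0) => [|a]; rewrite ?X1 ?eqxx // xa mul0mx.
Qed.

(** Here top and socle meet, so all arrows are kept in the cocycle bound; the vertex ranks leave
    only the loops at i. The identity at vertex i supplies one graded map, which cancels
    [homdim X X = 1]. *)
Lemma simple_extdim_le (k : fieldType) (Q : quiver) (X : amod k Q) (i : 'I_(qv Q)) :
  is_amod X -> is_brick X -> simple_at X i ->
  (extdim X X <= #|[pred a | (qs a == i) && (qt a == i)]|)%N.
Proof.
move=> mX bX sX; have vX j : \rank (aact X (inl j)) = (j == i).
  by have [] := simple_dims mX sX j.
have := extdim_graded_le mX mX; rewrite [homdim X X]bX.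
have := dim_graded_ge mX mX.
rewrite (bigD1 i) //= vX eqxx => /(leq_trans (leq_addr _ _)) g1 le.
have Zle : (\dim (arrow_cocycles X X)
            <= #|[pred a | (qs a == i) && (qt a == i)]|)%N.
  apply: leq_trans (dim_arrow_cocycles_le (P := xpredT) _) _ => //.
  rewrite -sum1_card [leqRHS]big_mkcond /=; apply: leq_sum => a _.
  by rewrite !vX inE mulnb; case: (_ && _).
have arith (e g z c : nat) : (1 <= g -> e + g <= z + 1 -> z <= c -> e <= c)%N by lia.
exact: arith g1 le Zle.
Qed.

(** Each edge has at most one orientation, so the arrow form is at most [r0 * r1 + r1 * r2]. The
    hypothesis then bounds the A_3 quadratic form at [r] by [1 - e]. That form is at least 1 on
    nonzero integer vectors, and where it equals 1 the vector is a root, with entries at most 1. *)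
Lemma thin_arith (n01 n10 n12 n21 : bool) (e t0 t1 t2 s0 s1 s2 r0 r1 r2 : nat) :
  ~~ (n01 && n10) -> ~~ (n12 && n21) ->
  r0 = maxn t0 s0 -> r1 = maxn t1 s1 -> r2 = maxn t2 s2 ->
  (0 < r0 + r1 + r2)%N ->
  (e + (r0 * r0 + r1 * r1 + r2 * r2)
     <= arrow_form n01 n10 n12 n21 t0 t1 t2 s0 s1 s2 + 1)%N ->
  [/\ e = 0%N, (r0 <= 1)%N, (r1 <= 1)%N & (r2 <= 1)%N].
Proof.
move=> o1 o2 E0 E1 E2 rpos le.
have le1 : (n01 * (t0 * s1) + n10 * (t1 * s0) <= r0 * r1)%N.
  have A : (t0 * s1 <= r0 * r1)%N by apply: leq_mul; lia.
  have B : (t1 * s0 <= r0 * r1)%N by rewrite mulnC; apply: leq_mul; lia.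
  by case: n01 n10 o1 {le} => -[] //= _; lia.
have le2 : (n12 * (t1 * s2) + n21 * (t2 * s1) <= r1 * r2)%N.
  have A : (t1 * s2 <= r1 * r2)%N by apply: leq_mul; lia.
  have B : (t2 * s1 <= r1 * r2)%N by rewrite mulnC; apply: leq_mul; lia.
  by case: n12 n21 o2 {le} => -[] //= _; lia.
have {le le1 le2} le : (e + (r0 * r0 + r1 * r1 + r2 * r2) <= r0 * r1 + r1 * r2 + 1)%N.
  by apply: leq_trans le _; rewrite leq_add2r; exact: leq_add.
have [c01 _] := nat_Cauchy r0 r1; have [c12 _] := nat_Cauchy r1 r2.
rewrite -!mulnn in c01 c12.
(* Doubling the inequality and bounding [2 * r0 * r1] and [2 * r1 * r2] by sums of squares cancels
   every term in [r1]. *)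
have c : (r0 * r0 + r2 * r2 <= 2)%N by lia.
have r0le : (r0 <= 1)%N by rewrite leqNgt; apply/negP => r0gt; have := leq_mul r0gt r0gt; lia.
have r2le : (r2 <= 1)%N by rewrite leqNgt; apply/negP => r2gt; have := leq_mul r2gt r2gt; lia.
have r1le : (r1 <= 1)%N.
  clear E0 E1 E2 c01 c12 c.
  case: r0 r2 r0le r2le rpos le => [|[|?]] [|[|?]] //= _ _ _ le; nia.
split=> //; clear E0 E1 E2 c01 c12 c.
case: r0 r1 r2 r0le r1le r2le rpos le => [|[|?]] [|[|?]] [|[|?]] //= _ _ _ _; lia.
Qed.

Lemma brick_nonsimple_thin (k : fieldType) (Q : quiver) (X : amod k Q) :
  (qv Q <= 3)%N -> path_shaped Q -> is_amod X -> (0 < adim X)%N -> is_brick X ->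
  (forall i, ~~ (in_top X i && in_socle X i)) ->
  extdim X X = 0%N /\ (forall i, vdim X i <= 1)%N.
Proof.
move=> n3 pQ mX dX bX disj.
have := extdim_euler_le mX mX disj; rewrite [homdim X X]bX sum_extend0 //.
rewrite (sum_arrows n3 pQ (topdim_socdim_disjoint disj)).
have sq i : extend0 (fun j => vdim X j * vdim X j)%N i
    = (extend0 (vdim X) i * extend0 (vdim X) i)%N.
  by rewrite /extend0; case: insub.
have vmax i : extend0 (vdim X) i = maxn (extend0 (topdim X) i) (extend0 (socdim X) i).
  by rewrite /extend0; case: insub => //= j; exact: vdim_max.
have vpos : (0 < extend0 (vdim X) 0 + extend0 (vdim X) 1 + extend0 (vdim X) 2)%N.
  have [[i ti] _] := top_socle_nonempty mX dX.
  rewrite -sum_extend0 // (bigD1 i) //= vdim_max // ltn_addr //.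
  by rewrite leq_max topdim_gt0 // ti.
rewrite !sq => le.
have [-> v0 v1 v2] := thin_arith (has_arrow_asym pQ (isT : 0 != 1)%N)
  (has_arrow_asym pQ (isT : 1 != 2)%N) (vmax 0%N) (vmax 1%N) (vmax 2%N) vpos le.
split=> // i; have i3 := leq_trans (ltn_ord i) n3.
rewrite -(extend0_val (vdim X)).
by case: (nat_of_ord i) i3 => [|[|[|?]]].
Qed.

Definition brick_level (k : fieldType) (Q : quiver) (X : amod k Q) : nat :=
  level (has_arrow Q 0 1) (has_arrow Q 1 0) (has_arrow Q 1 2) (has_arrow Q 2 1)
    (support3 (topdim X)) (support3 (socdim X)).

Lemma bool_form_support (n01 n10 n12 n21 : bool) (n : nat) (f g : 'I_n -> nat) :
  (forall j, f j <= 1)%N -> (forall j, g j <= 1)%N ->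
  arrow_form n01 n10 n12 n21 (extend0 f 0) (extend0 f 1) (extend0 f 2)
    (extend0 g 0) (extend0 g 1) (extend0 g 2)
  = bool_form n01 n10 n12 n21 (support3 f) (support3 g).
Proof. by move=> f1 g1; rewrite /bool_form /= -!extend0_thin. Qed.

Lemma tcount_support (n : nat) (f : 'I_n -> nat) :
  (n <= 3)%N -> (forall j, f j <= 1)%N -> tcount (support3 f) = (\sum_j f j)%N.
Proof.
by move=> n3 f1; rewrite sum_extend0 // /tcount /= -!extend0_thin.
Qed.

Lemma brick_thin (k : fieldType) (Q : quiver) (X : amod k Q) :
  (qv Q <= 3)%N -> path_shaped Q -> is_amod X -> (0 < adim X)%N -> is_brick X ->
  forall i, (vdim X i <= 1)%N.
Proof.
move=> n3 pQ mX dX bX.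
have [[i sX] j|disj] := brick_cases mX dX bX.
  by have [-> _ _] := simple_dims mX sX j; exact: leq_b1.
by have [_] := brick_nonsimple_thin n3 pQ mX dX bX disj.
Qed.

Lemma topdim_le_vdim (k : fieldType) (Q : quiver) (X : amod k Q) (i : 'I_(qv Q)) :
  (topdim X i <= vdim X i)%N.
Proof. by rewrite /topdim; case: ifP. Qed.

Lemma socdim_le_vdim (k : fieldType) (Q : quiver) (X : amod k Q) (i : 'I_(qv Q)) :
  (socdim X i <= vdim X i)%N.
Proof. by rewrite /socdim; case: ifP. Qed.

Lemma support_vdim (k : fieldType) (Q : quiver) (X : amod k Q) :
  is_amod X -> support3 (vdim X) = tor (support3 (topdim X)) (support3 (socdim X)).
Proof.
move=> mX; rewrite -support3_max /support3.
have E i : extend0 (vdim X) i = extend0 (fun j => maxn (topdim X j) (socdim X j)) i.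
  by rewrite /extend0; case: insub => //= j; exact: vdim_max.
by rewrite !E.
Qed.

Lemma brick_profileP (k : fieldType) (Q : quiver) (X : amod k Q) :
  (qv Q <= 3)%N -> path_shaped Q -> is_amod X -> (0 < adim X)%N -> is_brick X ->
  brick_profile (has_arrow Q 0 1) (has_arrow Q 1 0) (has_arrow Q 1 2) (has_arrow Q 2 1)
    (support3 (topdim X)) (support3 (socdim X)).
Proof.
move=> n3 pQ mX dX bX; have thin := brick_thin n3 pQ mX dX bX.
have tthin i := leq_trans (topdim_le_vdim X i) (thin i).
have sthin i := leq_trans (socdim_le_vdim X i) (thin i).
apply/orP; have [[i sX]|disj] := brick_cases mX dX bX.
  left; rewrite tcount_support // (eq_bigr (fun j => (j == i) : nat)); last first.
    by move=> j _; have [] := simple_dims mX sX j.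
  rewrite (bigD1 i) //= eqxx big1 ?addn0 ?eqxx ?andbT => [|j /negPf -> //].
  apply/eqP; rewrite /support3.
  have E l : extend0 (topdim X) l = extend0 (socdim X) l.
    rewrite /extend0; case: insub => //= j.
    by have [_ -> ->] := simple_dims mX sX j.
  by rewrite !E.
right; have [[i ti] [j sj]] := top_socle_nonempty mX dX.
have le := extdim_euler_le mX mX disj.
have ts0 := topdim_socdim_disjoint disj.
apply/and4P; split.
- by rewrite -sum_tcount // big1.
- by rewrite tcount_support // (bigD1 i) //= -lt0n ltn_addr // topdim_gt0.
- by rewrite tcount_support // (bigD1 j) //= -lt0n ltn_addr // socdim_gt0.
(* Vertex dimensions are at most one, so the size of the support is the sum of the squares of
   [vdim], which is the quantity the Euler inequality bounds. *)
have tt x : tand x x = x by case: x => [[a b] c]; rewrite /tand /= !andbb.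
rewrite -support_vdim // -[support3 (vdim X)]tt -sum_tcount //.
rewrite -bool_form_support // -sum_arrows // addnC.
by apply: leq_trans (leq_addl _ _) (leq_trans le _); rewrite [homdim X X]bX.
Qed.

(** With Hom(X, Y) = 0 and Ext(X, Y) nonzero, the Euler inequality becomes strict between the
    dimension pairing and the arrow form. Thinness rewrites both sides in terms of supports, and
    [level_lt] applies. *)
Lemma brick_level_lt (k : fieldType) (Q : quiver) (X Y : amod k Q) :
  (qv Q <= 3)%N -> path_shaped Q ->
  is_amod X -> (0 < adim X)%N -> is_brick X ->
  is_amod Y -> (0 < adim Y)%N -> is_brick Y ->
  homdim X Y = 0%N -> homdim Y X = 0%N -> extdim X Y != 0%N ->
  (brick_level X < brick_level Y)%N.
Proof.
move=> n3 pQ mX dX bX mY dY bY hXY hYX e0.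
have dXY := homdim0_disjoint mX mY hXY; have dYX := homdim0_disjoint mY mX hYX.
have Xthin := brick_thin n3 pQ mX dX bX; have Ythin := brick_thin n3 pQ mY dY bY.
have tX i := leq_trans (topdim_le_vdim X i) (Xthin i).
have sX i := leq_trans (socdim_le_vdim X i) (Xthin i).
have tY i := leq_trans (topdim_le_vdim Y i) (Ythin i).
have sY i := leq_trans (socdim_le_vdim Y i) (Ythin i).
apply: level_lt; try exact: has_arrow_asym; try exact: brick_profileP.
- by rewrite -sum_tcount // big1 // => i _; exact: topdim_socdim_disjoint.
- by rewrite -sum_tcount // big1 // => i _; exact: topdim_socdim_disjoint.
rewrite -!support_vdim // -sum_tcount // -bool_form_support // -sum_arrows //; last first.
  exact: topdim_socdim_disjoint.
have := extdim_euler_le mX mY dYX; rewrite hXY addn0; apply: leq_trans.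
by rewrite -[leqLHS]add1n leq_add2r lt0n.
Qed.

Lemma brick_extdim_le (k : fieldType) (Q : quiver) (X : amod k Q) (m : nat) :
  (qv Q <= 3)%N -> path_shaped Q -> is_amod X -> (0 < adim X)%N -> is_brick X ->
  (forall i : 'I_(qv Q), #|[pred a | (qs a == i) && (qt a == i)]| <= m)%N ->
  (extdim X X <= m)%N.
Proof.
move=> n3 pQ mX dX bX loops; have [[i sX]|disj] := brick_cases mX dX bX.
  exact: leq_trans (simple_extdim_le mX bX sX) (loops i).
by have [-> _] := brick_nonsimple_thin n3 pQ mX dX bX disj.
Qed.

(** * Spectral radius *)

Lemma char_poly_eigenseq (r : nat) (C : 'M[algC]_r) :
  char_poly C = \prod_(z <- eigenseq C) ('X - z%:P).
Proof.
have := svalP (closed_field_poly_normal (char_poly C)); rewrite -/(eigenseq C).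
by rewrite (eqP (char_poly_monic C)) scale1r.
Qed.

(* Ordering the indices by level makes B triangular; a left eigenvector is
   inspected at an index of minimal level in its support. *)
Lemma specrad_le (r : nat) (B : 'M[nat]_r) (lev : 'I_r -> nat) (m : nat) :
  (forall i, B i i <= m)%N ->
  (forall i j, i != j -> B i j != 0%N -> (lev i < lev j)%N) ->
  specrad_nat B <= m%:R.
Proof.
move=> diag tri; rewrite /specrad_nat /specrad; set C := map_mx _ B.
rewrite big_seq; apply: (big_ind (fun x : algC => x <= m%:R)) => [|x y xm ym|z]; first exact: ler0n.
  by rewrite /Order.max; case: ifP.
move=> zC; have /eigenvalueP[v vC v0] : eigenvalue C z.
  by rewrite eigenvalue_root_char char_poly_eigenseq root_prod_XsubC.
have [j0 vj0] : exists j, v 0 j != 0.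
  apply/existsP; rewrite -[X in is_true X]negbK negb_exists.
  apply: contra v0 => /forallP Z.
  by apply/eqP/rowP => j; rewrite mxE; apply/eqP; move: (Z j); rewrite negbK.
case: (@arg_minnP _ j0 (fun j => v 0 j != 0) lev vj0) => j vj minj.
have /eqP := congr1 (fun w : 'rV_r => w 0 j) vC.
(* By minimality of [j], each off-diagonal term has a zero coordinate of [v] or a zero entry of [B].
   What remains identifies [z] with [B j j]. *)
rewrite !mxE (bigD1 j) //= big1 => [|i ij].
  rewrite addr0 mulrC (inj_eq (mulIf vj)) mxE => /eqP <-.
  by rewrite normr_nat ler_nat.
have [->|vi] := eqVneq (v 0 i) 0; first by rewrite mul0r.
have [B0|Bn] := eqVneq (B i j) 0%N; first by rewrite mxE B0 mulr0.
by have := tri i j ij Bn; rewrite ltnNge minj.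
Qed.

Lemma specrad_nat_scalar (B : 'M[nat]_1) : specrad_nat B = (B 0 0)%:R.
Proof.
rewrite /specrad_nat /specrad; set C := map_mx _ B.
have C00 : C = (B 0 0)%:R%:M by rewrite [C]mx11_scalar mxE.
have := char_poly_eigenseq C; move: (eigenseq C) => s charE.
have : size s = 1%N.
  by apply: succn_inj; rewrite -(size_char_poly C) charE size_prod_XsubC.
case: s charE => [|z [|]] // charE _.
have : root (char_poly C) z by rewrite charE root_prod_XsubC mem_head.
rewrite C00 /char_poly det_mx11 !mxE eqxx !mulr1n rootE !hornerE subr_eq0 => /eqP ->.
by rewrite big_cons big_nil normr_nat /Order.max (le_gtF (ler0n _ _)).
Qed.

(** * Simple modules and the lower bound *)

Definition simple_amod (k : fieldType) (Q : quiver) (i : 'I_(qv Q)) : amod k Q :=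
  @AMod k Q 1 (fun g => if g == inl i then 1%:M else 0).

Lemma simple_amod_is_amod (k : fieldType) (Q : quiver) (i : 'I_(qv Q)) :
  is_amod (simple_amod k i).
Proof.
split=> [j l||a|a b] /=; rewrite ?mulmx0 ?mul0mx //.
  rewrite -![inl _ == inl _]/(_ == i).
  have [->|] := eqVneq j i; last by rewrite mul0mx; case: ifP.
  by rewrite mul1mx eq_sym; case: ifP.
rewrite (bigD1 i) //= eqxx big1 ?addr0 // => j ji.
by rewrite -[inl j == inl i]/(j == i) (negPf ji).
Qed.

Lemma simple_amod_d0 (k : fieldType) (Q : quiver) (i : 'I_(qv Q)) :
  linfun (@d0 k Q (simple_amod k i) (simple_amod k i)) = 0.
Proof.
apply/lfunP => h; rewrite lfunE zero_lfunE; apply/ffunP => g; rewrite !ffunE /=.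
by case: ifP => _; rewrite ?mul1mx ?mulmx1 ?mul0mx ?mulmx0 subrr.
Qed.

Lemma simple_amod_brick (k : fieldType) (Q : quiver) (i : 'I_(qv Q)) :
  is_brick (simple_amod k i).
Proof.
rewrite /is_brick /homdim simple_amod_d0.
have -> : lker (0 : 'Hom('M[k]_(1, 1), {ffun qgen Q -> 'M[k]_(1, 1)})) = fullv.
  by apply/eqP; rewrite eqEsubv subvf; apply/subvP => h _; rewrite memv_ker zero_lfunE.
by rewrite dimvf dim_matrix.
Qed.

(** Since [d0] vanishes on the simple module, there are no coboundaries to divide out. Each loop at
    i carries a line of cocycles supported on it alone, and these lines are independent. *)
Lemma simple_amod_extdim_ge (k : fieldType) (Q : quiver) (i : 'I_(qv Q)) :
  (#|[pred a | (qs a == i) && (qt a == i)]|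
     <= extdim (simple_amod k i) (simple_amod k i))%N.
Proof.
set S := simple_amod k i; rewrite /extdim simple_amod_d0 -/S.
have -> : limg (0 : 'Hom('M[k]_(1, 1), {ffun qgen Q -> 'M[k]_(1, 1)})) = 0%VS.
  by rewrite lim0g.
rewrite dimv0 subn0.
pose U a := limg (linfun (@single_arrow k Q 'M[k]_(1, 1) a)).
have dimU a : \dim (U a) = 1%N.
  rewrite limg_dim_eq ?dimvf ?dim_matrix //.
  apply/eqP; rewrite -subv0; apply/subvP => E; rewrite memv_cap memv_ker lfunE memv0.
  by case/andP => _ /eqP/ffunP/(_ (inr a)); rewrite !ffunE eqxx => ->.
pose P a := (qs a == i) && (qt a == i).
rewrite -sum1_card (eq_bigl P) // -(eq_bigr _ (fun a _ => dimU a)).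
have /directvP /= <- : directv (\sum_(a | P a) U a).
  apply/directv_sum_independent => us Uus us0 a Pa.
  have /memv_imgP[E _ usa] := Uus a Pa; rewrite usa lfunE.
  have /ffunP/(_ (inr a)) := us0; rewrite sum_ffunE (bigD1 a) //= big1 => [|b].
    by rewrite addr0 usa lfunE !ffunE eqxx => ->; rewrite linear0.
  case/andP => Pb ba; have /memv_imgP[G _ ->] := Uus b Pb.
  by rewrite lfunE ffunE -[inr a == inr b]/(a == b) eq_sym (negPf ba).
apply/dimvS/subv_sumP => a /andP[/eqP sa /eqP ta]; apply/subvP => _ /memv_imgP[E _ ->].
have : single_arrow a E \in arrow_cocycles S S.
  apply/arrow_cocyclesP; split=> [j|b|b|b c]; rewrite !ffunE //=.
  - rewrite -[inr b == inr a]/(b == a) -[inl _ == inl _]/(qt b == i).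
    by case: (eqVneq b a) => [->|_]; rewrite ?mulmx0 // ta eqxx mul1mx.
  - rewrite -[inr b == inr a]/(b == a) -[inl _ == inl _]/(qs b == i).
    by case: (eqVneq b a) => [->|_]; rewrite ?mul0mx // sa eqxx mulmx1.
  - by rewrite mul0mx mulmx0 addr0.
by rewrite lfunE => /memv_capP[].
Qed.

Theorem theorem6p1 (k : closedFieldType) (Q : quiver) (N : 'I_(qv Q) -> nat) :
  (1 <= qv Q <= 3)%N ->
  (* N_i loops at vertex i *)
  (forall i : 'I_(qv Q), #|[pred a | (qs a == i) && (qt a == i)]| = N i) ->
  (* non-loop arrows: the underlying graph is the path A_n on 0,...,n-1 *)
  (forall i j : 'I_(qv Q), i != j ->
     #|[pred a | ((qs a == i) && (qt a == j)) || ((qs a == j) && (qt a == i))]|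
       = (if (i.+1 == j) || (j.+1 == i) then 1 else 0)%N) ->
  let m := (\max_(i : 'I_(qv Q)) N i)%N in
  (forall phi : seq (amod k Q), brick_set phi -> specrad_nat (adjmx phi) <= m%:R) /\
  (forall e : algC, 0 < e ->
     exists2 phi : seq (amod k Q), brick_set phi & m%:R - e < specrad_nat (adjmx phi)).
Proof.
move=> /andP[n1 n3] loops pQ m; split=> [phi bphi|e e0].
  have mem i := let: And3 mX dX _ := bphi i i in conj mX dX.
  have brk i : is_brick (tnth (in_tuple phi) i).
    by have [_ _] := bphi i i; rewrite eqxx.
  apply: (@specrad_le _ _ (fun i => brick_level (tnth (in_tuple phi) i))).
    move=> i; rewrite mxE; have [mX dX] := mem i.
    apply: brick_extdim_le => // j; rewrite loops; exact: leq_bigmax.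
  move=> i j ij; rewrite mxE => e0.
  have [mX dX] := mem i; have [mY dY] := mem j.
  have [_ _ hij] := bphi i j; have [_ _ hji] := bphi j i.
  rewrite (negPf ij) in hij; rewrite eq_sym (negPf ij) in hji.
  exact: brick_level_lt e0.
(* There is at least one vertex, so the maximum is attained at some [i0]; the single brick there
   reaches the bound [m] and serves every [e]. *)
have [|i0 mi0] := @bigop.eq_bigmax _ N; first by rewrite card_ord.
exists [:: simple_amod k i0].
  move=> i j; rewrite [i]ord1 [j]ord1 /= !(tnth_nth (simple_amod k i0)) /=.
  by split=> //; [exact: simple_amod_is_amod|exact: simple_amod_brick].
have le : m%:R <= specrad_nat (adjmx [:: simple_amod k i0]).
  rewrite specrad_nat_scalar ler_nat mxE (tnth_nth (simple_amod k i0)) /= /m mi0 -loops.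
  exact: simple_amod_extdim_ge.
by apply: lt_le_trans le; rewrite ltrBlDr ltrDl.
Qed.
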